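(* For every real $q>1$, the sketch $q$-$\mathsf{PCSA}$ is weakly scale-invariant with base $q$, and \[ \mathcal{H}(q\text{-}\mathsf{PCSA})=\frac{H_0}{\ln q},\qquad \mathcal{I}(q\text{-}\mathsf{PCSA})=\frac{I_0}{\ln q},\qquad\text{hence}\qquad \mathsf{Fish}(q\text{-}\mathsf{PCSA})=\frac{H_0}{I_0}\approx 1.98016 . \]
   Context: A sketch is described by its induced distribution family: for each cardinality (Poissonized time) $\lambda>0$, a distribution $\psi_\lambda$ on a state space; $X_\lambda\sim\psi_\lambda$. Entropy $H(X_\lambda)=-\sum_x\psi_\lambda(x)\log_2\psi_\lambda(x)$ and Fisher information $I(\lambda)=\sum_x (\frac{\partial}{\partial\lambda}\psi_\lambda(x))^2/\psi_\lambda(x)$. A sketch is weakly scale-invariant with base $q>1$ if for all $\lambda>0$: $H(X_\lambda)=H(X_{q\lambda})$ and $I(\lambda)=q^2 I(q\lambda)$. For such a sketch $A$, define $\mathcal{H}(A)=\int_0^1 H(X_{q^r})\,dr$, $\mathcal{I}(A)=\int_0^1 q^{2r}I(q^r)\,dr$, and $\mathsf{Fish}(A)=\mathcal{H}(A)/\mathcal{I}(A)$. The sketch $q$-$\mathsf{PCSA}$: the state is a bit vector $(b_k)_{k\in\mathbb{Z}}$ whose coordinates are independent, with $\Pr(b_k=0)=e^{-\lambda/q^k}$ and $\Pr(b_k=1)=1-e^{-\lambda/q^k}$ at cardinality $\lambda$; its entropy and Fisher information are the sums over $k\in\mathbb Z$ of the entropies and Fisher informations of the individual coordinates. Constants: with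 $h(x)=-x\ln x-(1-x)\ln(1-x)$ and $g(x)=x^2/(e^x-1)$, $H_0=\frac{1}{\ln 2}\int_{-\infty}^\infty h(e^{-e^w})\,dw$ and $I_0=\int_{-\infty}^\infty g(e^w)\,dw$. *)

(* Defs.v *)
From HB Require Import structures.
From mathcomp Require Import all_boot all_order all_algebra.
From mathcomp Require Import all_classical all_reals all_analysis.
Set Implicit Arguments. Unset Strict Implicit. Unset Printing Implicit Defensive.
Import Order.TTheory GRing.Theory Num.Theory.
Import numFieldNormedType.Exports.
Local Open Scope classical_set_scope.
Local Open Scope ring_scope.

Section Defs.
Variable R : realType.

Definition log2 (x : R) : R := ln x / ln 2.

(* Shannon entropy (bits) of a distribution on bool; ln 0 = 0 in mathcomp,
   so the convention 0 log 0 = 0 holds. *)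
Definition entropy_bool (p : bool -> R) : R :=
  - \sum_(b : bool) p b * log2 (p b).

Definition fisher_bool (psi : R -> bool -> R) (lam : R) : R :=
  \sum_(b : bool) (derive1 (fun l => psi l b) lam) ^+ 2 / psi lam b.

(* Distribution of coordinate b_k of q-PCSA at cardinality lam:
   Pr(b_k = 0) = exp(-lam/q^k), Pr(b_k = 1) = 1 - exp(-lam/q^k). *)
Definition pcsa_coord (q : R) (k : int) (lam : R) (b : bool) : R :=
  if b then 1 - expR (- (lam / q ^ k)) else expR (- (lam / q ^ k)).

(* Entropy and Fisher information of q-PCSA: sums over k in Z
   (nonnegative terms, summed with esum in the extended reals). *)
Definition pcsa_H (q lam : R) : \bar R :=
  (\esum_(k in [set: int]) (entropy_bool (pcsa_coord q k lam))%:E)%E.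

Definition pcsa_I (q lam : R) : \bar R :=
  (\esum_(k in [set: int]) (fisher_bool (pcsa_coord q k) lam)%:E)%E.

Definition weakly_scale_invariant (H I : R -> \bar R) (q : R) : Prop :=
  forall lam : R, 0 < lam ->
    H lam = H (q * lam)%R /\ I lam = ((q ^+ 2)%R%:E * I (q * lam)%R)%E.

Definition calH (H : R -> \bar R) (q : R) : \bar R :=
  (\int[lebesgue_measure]_(r in `[0%R, 1%R]) H (q `^ r)%R)%E.

Definition calI (I : R -> \bar R) (q : R) : \bar R :=
  (\int[lebesgue_measure]_(r in `[0%R, 1%R]) ((q `^ (2 * r)%R)%R%:E * I (q `^ r)%R))%E.

Definition Fish (H I : R -> \bar R) (q : R) : R :=
  fine (calH H q) / fine (calI I q).

Definition hfun (x : R) : R := - (x * ln x) - (1 - x) * ln (1 - x).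
Definition gfun (x : R) : R := x ^+ 2 / (expR x - 1).

Definition H0 : \bar R :=
  ((ln 2)^-1%:E * \int[lebesgue_measure]_(w in [set: R]) (hfun (expR (- expR w)))%:E)%E.

Definition I0 : \bar R :=
  (\int[lebesgue_measure]_(w in [set: R]) (gfun (expR w))%:E)%E.

End Defs.

(* Main.v *)
Require Import Defs.
From HB Require Import structures.
From mathcomp Require Import all_boot all_order all_algebra.
From mathcomp Require Import all_classical all_reals all_analysis.
From mathcomp Require Import measurable_realfun ring lra.
Import Order.TTheory GRing.Theory Num.Theory.
Import numFieldNormedType.Exports.
Local Open Scope classical_set_scope.
Local Open Scope ring_scope.
Set Implicit Arguments.
Unset Strict Implicit.
Unset Printing Implicit Defensive.

(** With [lambda = q ^ r], the [k]-th coordinate contributes [f (r - k)] to the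
    entropy (and to [lambda ^ 2] times the Fisher information) for a fixed [f], so
    integrating the sum over [k] over the unit interval integrates [f] over the
    whole line.

    Expanding [1 / (e ^ x - 1)] and [ln (1 - e ^ (- x))] in powers of [e ^ (- x)]
    and integrating termwise gives [I0 = sum 1 / n ^ 2] and
    [H0 * ln 2 = 1 + sum ln (1 + 1 / n) / n], the latter by Frullani integrals.
    The first 12 terms of each series are enclosed using Taylor bounds for the
    logarithm, the tails by telescoping against truncated asymptotic expansions
    in [1 / n] of the remainders. *)

Local Notation mu := lebesgue_measure.

(** * Integrals over the real line *)

Lemma is_derive1_continuous (R : realType) (f F : R -> R) :
  (forall x : R, is_derive x 1 F (f x)) -> continuous F.
Proof.
move=> dF x; apply: differentiable_continuous; apply/derivable1_diffP.
by have [] := dF x.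
Qed.

(** The line is cut at 0 and the left half reflected, with antiderivative [- F (- x)], so that the
    fundamental theorem on [[0, +oo[] covers both halves; the two values at 0 cancel. *)
Lemma ge0_continuous_FTC2T (R : realType) (f F : R -> R) (l l' : R) :
  (forall x, 0 <= f x) -> continuous f ->
  (forall x : R, is_derive x 1 F (f x)) ->
  F x @[x --> -oo] --> l -> F x @[x --> +oo] --> l' ->
  (\int[@lebesgue_measure R]_x (f x)%:E = (l' - l)%:E)%E.
Proof.
move=> f0 cf dF Fl Fl'.
have cF : continuous F by exact: is_derive1_continuous dF.
have mf : measurable_fun setT f by exact: continuous_measurable_fun.
have cNf : continuous (fun x => f (- x)).
  by move=> x; apply: continuous_comp; [exact: continuousN|exact: cf].
have dNF (x : R) : is_derive x 1 (fun x => - F (- x)) (f (- x)).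
  have := @is_derive1_comp R F (-%R) x (f (- x)) (- 1) _ _.
  move=> /(_ (dF _) _) d.
  by apply: is_derive_eq; rewrite mulrN1 opprK.
have setTE : [set: R] = `]-oo, 0] `|` `]0, +oo[.
  apply/seteqP; split => // x _ /=; rewrite !in_itv/= andbT.
  by case: (leP x 0) => ?; [left|right].
rewrite setTE ge0_integral_setU//=; last 3 first.
- by apply: measurable_funTS; exact/measurable_EFinP.
- by move=> x _; rewrite lee_fin.
- apply/disj_setPS => x /=; rewrite !in_itv/= andbT => -[x0 x1].
  by move: (lt_le_trans x1 x0); rewrite ltxx.
rewrite integral_itv_obnd_cbnd; last first.
  by apply: measurable_funTS; exact/measurable_EFinP.
have -> : (\int[@lebesgue_measure R]_(x in `]-oo, 0%R]) (f x)%:E =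
           \int[@lebesgue_measure R]_(x in `[0%R, +oo[) (f (- x))%:E)%E.
  rewrite (ge0_integration_by_substitution0 (f := fun x => (f (- x))%:E))//.
  - by apply: eq_integral => x _; rewrite opprK.
  - apply/measurable_EFinP; exact: continuous_measurable_fun.
  - by move=> x; rewrite lee_fin.
have -> : (\int[@lebesgue_measure R]_(x in `[0%R, +oo[) (f (- x))%:E =
           (- l)%:E - (- F (- 0))%:E)%E.
  apply: (@ge0_continuous_FTC2y R (fun x => f (- x)) (fun x => - F (- x))).
  - by move=> x _; exact: f0.
  - exact: continuous_subspaceT.
  - apply: cvgN; exact: (proj1 (cvgNy_compNP F (nbhs l)) Fl).
  - by move=> x _; have [] := dNF x.
  - apply: cvgN; apply: cvg_at_right_filter.
    by apply: continuous_comp; [exact: continuousN|exact: cF].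
  - by move=> x _; rewrite derive1E; have dNFx := dNF x; exact: derive_val.
rewrite (ge0_continuous_FTC2y (F := F) (l := l'))//=.
- by rewrite oppr0 -!EFinB -EFinD; congr EFin; ring.
- exact: continuous_subspaceT.
- by apply: cvg_at_right_filter; exact: cF.
- by move=> x _; rewrite derive1E; exact: derive_val.
Qed.

Lemma is_derive1_shift (R : realType) (f F : R -> R) (c x : R) :
  (forall x : R, is_derive x 1 F (f x)) ->
  is_derive x 1 (fun y => F (y + c)) (f (x + c)).
Proof.
move=> dF.
have := @is_derive1_comp R F (shift c) x _ _ (dF _) (is_derive_shift x 1 c).
by rewrite mulr1.
Qed.

Lemma continuous_comp_shift (R : realType) (f : R -> R) (c : R) :
  continuous f -> continuous (fun y => f (y + c)).
Proof.
move=> cf x; apply: (@continuous_comp _ _ _ (shift c) f); last exact: cf.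
exact: (is_derive1_continuous (fun x => is_derive_shift x 1 c)).
Qed.

(** A translation does not change the limits of [F] at infinity, so the value is independent of
    [c]. *)
Lemma ge0_continuous_FTC2T_shift (R : realType) (f F : R -> R) (l l' c : R) :
  (forall x, 0 <= f x) -> continuous f ->
  (forall x : R, is_derive x 1 F (f x)) ->
  F x @[x --> -oo] --> l -> F x @[x --> +oo] --> l' ->
  (\int[@lebesgue_measure R]_x (f (x + c)%R)%:E = (l' - l)%:E)%E.
Proof.
move=> f0 cf dF Fl Fl'.
apply: (@ge0_continuous_FTC2T R (fun x => f (x + c)) (fun x => F (x + c))).
- by move=> x; exact: f0.
- exact: continuous_comp_shift.
- by move=> x; exact: is_derive1_shift.
- by apply: cvg_comp Fl; exact: cvg_addrr_Ny.
- by apply: cvg_comp Fl'; exact: cvg_addrr.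
Qed.

(** An explicit enumeration of the integers, used to turn sums over [int] into series over [nat],
    which commute with integrals of nonnegative functions. *)
Definition int_of_code (n : nat) : int := if odd n then Negz n./2 else Posz n./2.

Lemma int_of_code_bij : set_bij [set: nat] [set: int] int_of_code.
Proof.
rewrite setTT_bijective.
exists (fun z => match z with Posz m => m.*2 | Negz m => m.*2.+1 end).
  by move=> n; rewrite /int_of_code; have := odd_double_half n; case: (odd n).
by case=> m; rewrite /int_of_code/= odd_double/= ?uphalf_double ?doubleK.
Qed.

Lemma integral_itv01_shift (R : realType) (f : R -> R) (c : R) :
  continuous f ->
  (\int[mu]_(x in `[c, (c + 1)%R[) (f x)%:E =
   \int[mu]_(x in `[0%R, 1%R]) (f (x + c)%R)%:E)%E.
Proof.
move=> cf.
have dF (x : R) : is_derive x 1 (fun y => y + c) 1.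
  exact: (@is_derive_shift R x 1 c).
have F' : (fun y : R => y + c)^`()%classic = cst 1.
  by apply/funext => x; rewrite derive1E; exact: derive_val.
rewrite integral_itv_bndo_bndc; last first.
  by apply: measurable_funTS; apply/measurable_EFinP; exact: continuous_measurable_fun.
have := @integration_by_substitution_increasing R (fun y => y + c) f 0 1 ler01.
rewrite add0r [1 + c]addrC F' => ->.
- by apply: eq_integral => x _ /=; rewrite /GRing.mul/= mulr1.
- by move=> x y _ _ xy; rewrite ltrD2r.
- by move=> x _; exact: cst_continuous.
- exact: is_cvg_cst.
- exact: is_cvg_cst.
- have cF : continuous (fun y : R => y + c) by exact: is_derive1_continuous dF.
  split; first by move=> x _; have [] := dF x.
    by apply: cvg_at_right_filter; exact: cF.
  by apply: cvg_at_left_filter; exact: cF.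
- exact: continuous_subspaceT.
Qed.

(* Cutting the real line into the intervals [k, k + 1) turns the integral of
   the periodization into the integral over the whole line. *)
Lemma integral_periodization (R : realType) (f : R -> R) :
  (forall x, 0 <= f x) -> continuous f ->
  (\int[mu]_(x in `[0%R, 1%R]) (\esum_(k in [set: int]) (f (x - k%:~R)%R)%:E) =
   \int[mu]_x (f x)%:E)%E.
Proof.
move=> f0 cf.
have mf : measurable_fun setT f by exact: continuous_measurable_fun.
pose e n := - int_of_code n.
have be : set_bij [set: nat] [set: int] int_of_code := int_of_code_bij.
(* The minus sign matches the argument [x - k]: on the interval starting at [- k], the substitution
   by a point of the unit interval reads [f (x - k)]. *)
pose I n := `[(- (int_of_code n)%:~R : R), - (int_of_code n)%:~R + 1[%classic.
have UI : \bigcup_n I n = [set: R].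
  apply/seteqP; split => // x _.
  have [_ _ /(_ (- Num.floor x) Logic.I)[n _ en]] := be.
  exists n => //; rewrite /I /= in_itv/= en mulrNz opprK.
  by rewrite -(intrD _ _ 1); exact: floor_itv.
have tI : trivIset setT I.
  move=> m n _ _ [x []]; rewrite /I/= !in_itv/= => xm xn.
  have := set_bij_inj be; apply; rewrite ?inE//.
  (* Both left endpoints are the floor of the common point [x], hence equal. *)
  apply: oppr_inj; rewrite -[LHS](@floor_def R x) -?[RHS](@floor_def R x)//.
  - by rewrite intrD mulrNz.
  - by rewrite intrD mulrNz.
rewrite -UI ge0_integral_bigcup//=; last 3 first.
- by move=> n; exact: measurable_itv.
- by rewrite UI; apply/measurable_EFinP.
- by move=> x _; rewrite lee_fin.
under eq_eseriesr => n _ do rewrite integral_itv01_shift//.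
rewrite -integral_nneseries//.
- apply: eq_integral => x _.
  rewrite (reindex_esum _ _ _ _ be) nneseries_esumT//.
  by move=> n; rewrite lee_fin.
- move=> n; apply/measurable_EFinP; apply: measurable_funTS.
  apply: continuous_measurable_fun => x; apply: continuous_comp; last exact: cf.
  exact: (is_derive1_continuous (fun x => is_derive_shift x 1 _)).
- by move=> n x _; rewrite lee_fin.
Qed.

(** * Entropy and Fisher information of the coordinates *)

Lemma is_derive_expR_scale (R : realType) (c x : R) :
  is_derive x 1 (fun l => expR (- (l / c))) (- expR (- (x / c)) / c).
Proof.
have d : is_derive x 1 (fun l : R => - (l / c)) (- c^-1).
  have -> : (fun l : R => - (l / c)) = (- c^-1) *: id.
    by apply/funext => l; rewrite [RHS]mulNr mulrC.
  by apply: is_derive_eq; rewrite /GRing.scale/= mulr1.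
have := @is_derive1_comp R expR (fun l => - (l / c)) x _ _ (is_derive_expR _) d.
by rewrite mulrN mulNr.
Qed.

Lemma entropy_pcsa_coord (R : realType) (q : R) (k : int) (lam : R) :
  entropy_bool (pcsa_coord q k lam) =
  (ln 2)^-1 * hfun (expR (- (lam / q ^ k))).
Proof. by rewrite /entropy_bool big_bool /pcsa_coord /log2 /hfun/=; ring. Qed.

(** With [x = lam / q ^ k] the two derivatives are opposite, of size [e ^ (- x) / q ^ k], and the
    two quotients add up to [1 / (q ^ (2 k) (e ^ x - 1))]; then [1 / q ^ k = x / lam]. *)
Lemma fisher_pcsa_coord (R : realType) (q : R) (k : int) (lam : R) :
  0 < q -> 0 < lam ->
  fisher_bool (pcsa_coord q k) lam = (lam ^+ 2)^-1 * gfun (lam / q ^ k).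
Proof.
move=> q0 lam0; rewrite /fisher_bool big_bool /pcsa_coord /gfun/=.
set c := q ^ k; have c0 : 0 < c by exact: exprz_gt0.
have d0 := is_derive_expR_scale c lam.
have d1 : is_derive lam 1 (fun l => 1 - expR (- (l / c)))
    (expR (- (lam / c)) / c).
  have -> : (fun l : R => 1 - expR (- (l / c))) =
      cst 1 - (fun l : R => expR (- (l / c))) by [].
  by apply: is_derive_eq; rewrite sub0r mulNr opprK.
rewrite !derive1E (@derive_val _ _ _ _ _ _ _ d0) (@derive_val _ _ _ _ _ _ _ d1).
have x0 : 0 < lam / c by rewrite divr_gt0.
rewrite expRN.
have e1 : expR (lam / c) - 1 != 0 by rewrite subr_eq0 gt_eqF// expR_gt1.
set E := expR (lam / c) in e1 *.
have E0 : E != 0 by rewrite gt_eqF// expR_gt0.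
have := lt0r_neq0 c0; have := lt0r_neq0 lam0 => l0 c0'.
by field; rewrite E0 e1 c0' l0.
Qed.

(** Multiplying [lam] by [q] amounts to the index shift [k + 1], a bijection of the integers. This
    is the whole source of the scale invariance. *)
Lemma esum_scale (R : realType) (f : R -> \bar R) (q lam : R) : q != 0 ->
  (\esum_(k in [set: int]) f (q * lam / q ^ k)%R =
   \esum_(k in [set: int]) f (lam / q ^ k)%R)%E.
Proof.
move=> q0.
have sb : set_bij [set: int] [set: int] (fun k => k + 1).
  by rewrite setTT_bijective; exists (fun k => k - 1) => k; rewrite ?addrK ?subrK.
rewrite (reindex_esum _ _ _ _ sb); apply: eq_esum => k _.
by rewrite expfzDr// expr1z -mulf_div mulrC; congr f; field; rewrite q0 expfz_neq0.
Qed.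

Lemma esumZl_EFin (R : realType) (f : int -> R) (c : R) :
  0 <= c -> (forall k, 0 <= f k) ->
  (\esum_(k in [set: int]) (c * f k)%:E =
   c%:E * \esum_(k in [set: int]) (f k)%:E)%E.
Proof.
move=> c0 f0; have be := int_of_code_bij.
rewrite !(reindex_esum _ _ _ _ be) -!nneseries_esumT => [|n|n]; last 2 first.
- by rewrite lee_fin.
- by rewrite lee_fin mulr_ge0.
by rewrite -nneseriesZl => [|n _]; rewrite ?lee_fin.
Qed.

Lemma hfun_ge0 (R : realType) (x : R) : 0 <= x <= 1 -> 0 <= hfun x.
Proof.
move=> /andP[x0 x1]; rewrite /hfun -opprD oppr_ge0 -oppr_ge0 opprD.
by rewrite addr_ge0// -mulrN mulr_ge0// ?oppr_ge0 ?ln_le0 ?subr_ge0// gerBl.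
Qed.

Lemma gfun_ge0 (R : realType) (x : R) : 0 <= x -> 0 <= gfun x.
Proof.
by move=> x0; rewrite /gfun divr_ge0 ?sqr_ge0// subr_ge0 -expR0 ler_expR.
Qed.

Lemma expRN_expR_itv (R : realType) (w : R) : 0 < expR (- expR w) < 1.
Proof. by rewrite expR_gt0 expR_lt1 oppr_lt0 expR_gt0. Qed.

Lemma pcsa_HE (R : realType) (q lam : R) :
  pcsa_H q lam =
  (\esum_(k in [set: int]) ((ln 2)^-1 * hfun (expR (- (lam / q ^ k))))%:E)%E.
Proof. by apply: eq_esum => k _; rewrite entropy_pcsa_coord. Qed.

Lemma pcsa_IE (R : realType) (q lam : R) : 0 < q -> 0 < lam ->
  pcsa_I q lam =
  ((lam ^+ 2)^-1%:E * \esum_(k in [set: int]) (gfun (lam / q ^ k))%:E)%E.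
Proof.
move=> q0 lam0; rewrite -esumZl_EFin ?invr_ge0 ?sqr_ge0//.
  by apply: eq_esum => k _; rewrite fisher_pcsa_coord.
by move=> k; rewrite gfun_ge0// divr_ge0// ltW// exprz_gt0.
Qed.

Lemma pcsa_weakly_scale_invariant (R : realType) (q : R) : 0 < q ->
  weakly_scale_invariant (pcsa_H q) (pcsa_I q) q.
Proof.
move=> q0 lam lam0; have qn0 := lt0r_neq0 q0; split.
  rewrite !pcsa_HE.
  by rewrite (esum_scale (fun x => ((ln 2)^-1 * hfun (expR (- x)))%:E)).
rewrite !pcsa_IE ?mulr_gt0// (esum_scale (fun x => (gfun x)%:E))//.
rewrite muleA -EFinM; congr ((_)%:E * _)%E.
by field; rewrite qn0 lt0r_neq0.
Qed.

Lemma continuous_hfun_comp (R : realType) :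
  continuous (fun w : R => hfun (expR (- expR w))).
Proof.
move=> w; have /andP[p0 p1] := expRN_expR_itv w.
have cp : {for w, continuous (fun w : R => expR (- expR w))}.
  apply: (@continuous_comp _ _ _ (fun w : R => - expR w) expR).
    by apply: continuousN; exact: continuous_expR.
  exact: continuous_expR.
(* Both logarithms in [hfun] have positive arguments only on the open unit interval, where
   [expRN_expR_itv] places the inner function. *)
have h (x : R) : 0 < x -> x < 1 -> {for x, continuous (@hfun R)}.
  move=> x0 x1; apply: cvgB.
    by apply: cvgN; apply: cvgM; [exact: cvg_id|exact: continuous_ln].
  have c1 : {for x, continuous (fun y : R => 1 - y)}.
    by apply: cvgB; [exact: cvg_cst|exact: cvg_id].
  apply: cvgM; first exact: c1.
  apply: cvg_comp; first exact: c1.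
  by apply: continuous_ln; rewrite subr_gt0.
apply: (@continuous_comp _ _ _ (fun w : R => expR (- expR w)) (@hfun R)).
  exact: cp.
exact: h.
Qed.

Lemma continuous_gfun_comp (R : realType) : continuous (fun w : R => gfun (expR w)).
Proof.
move=> w.
have h (x : R) : 0 < x -> {for x, continuous (@gfun R)}.
  move=> x0; apply: cvgM.
    exact: exprn_continuous.
  apply: cvgV; first by rewrite subr_eq0 gt_eqF// expR_gt1.
  by apply: cvgB; [exact: continuous_expR|exact: cvg_cst].
apply: (@continuous_comp _ _ _ expR (@gfun R)); first exact: continuous_expR.
exact/h/expR_gt0.
Qed.

(** * Averages over one period of the scale *)

Lemma integral_scale (R : realType) (f : R -> R) (a : R) : 0 < a ->
  continuous f -> (forall x, 0 <= f x) ->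
  (\int[lebesgue_measure]_x (f (a * x)%R)%:E =
   a^-1%:E * \int[lebesgue_measure]_x (f x)%:E)%E.
Proof.
move=> a0 cf f0.
have dF (x : R) : is_derive x 1 (fun y => a * y) a.
  by apply: (@is_derive_eq _ _ _ (a *: id)); rewrite /GRing.scale/= mulr1.
have F' : (fun y : R => a * y)^`()%classic = cst a.
  by apply/funext => x; rewrite derive1E; exact: derive_val.
have cF : continuous (fun y : R => a * y) by exact: is_derive1_continuous dF.
have := @increasing_ge0_integration_by_substitutionT R (fun y => a * y) f.
rewrite F' => -> //.
- transitivity (a^-1%:E * \int[lebesgue_measure]_x (a%:E * (f (a * x)%R)%:E))%E;
    last first.
    by congr (_ * _)%E; apply: eq_integral => x _; rewrite -EFinM mulrC.
  rewrite ge0_integralZl_EFin//.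
  + by rewrite muleA -EFinM mulVf ?gt_eqF// mul1e.
  + by move=> x _; rewrite lee_fin.
  + apply/measurable_EFinP; apply: continuous_measurable_fun => x.
    by apply: continuous_comp; [exact: cF|exact: cf].
  + exact: ltW.
- by move=> x y xy; rewrite ltr_pM2l.
- exact: cst_continuous.
- exact: is_cvg_cst.
- exact: is_cvg_cst.
- exact: gt0_cvgMrNy.
- exact: gt0_cvgMry.
Qed.

(** In logarithmic scale the [k]-th coordinate sees only [r - k], which makes the sums over [k]
    periodizations. *)
Lemma expR_ln_sub (R : realType) (q r : R) (k : int) : 0 < q ->
  q `^ r / q ^ k = expR (ln q * (r - k%:~R)).
Proof.
move=> q0; rewrite -powR_intmul ?ltW// -powRB; last by rewrite (gt_eqF q0) implybT.
by rewrite /powR gt_eqF// mulrC.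
Qed.

Lemma calH_pcsa (R : realType) (q : R) : 1 < q ->
  calH (pcsa_H q) q = (H0 R * ((ln q)^-1)%:E)%E.
Proof.
move=> q1; have q0 : 0 < q by apply: lt_trans q1.
have a0 : 0 < ln q by exact: ln_gt0.
pose f (w : R) := (ln 2)^-1 * hfun (expR (- expR w)).
have l2 : 0 <= (ln 2)^-1 :> R by rewrite invr_ge0 ln_ge0// ler1n.
have h0 (w : R) : 0 <= hfun (expR (- expR w)).
  by have /andP[p0 p1] := expRN_expR_itv w; rewrite hfun_ge0// !ltW.
have f0 w : 0 <= f w by rewrite mulr_ge0.
have cf : continuous f.
  by move=> w; apply: cvgM; [exact: cvg_cst|exact: continuous_hfun_comp].
have cfa : continuous (fun x => f (ln q * x)).
  move=> x; apply: (@continuous_comp _ _ _ (fun x => ln q * x) f); last exact: cf.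
  by apply: cvgM; [exact: cvg_cst|exact: cvg_id].
rewrite /calH; under eq_integral => r _.
  rewrite pcsa_HE; under eq_esum => k _ do rewrite expR_ln_sub//.
  over.
(* The periodized function is [f (ln q * x)]; undoing the dilation produces the factor
   [1 / ln q]. *)
rewrite (integral_periodization (f := fun x => f (ln q * x)))// integral_scale//.
rewrite muleC; congr (_ * _)%E; rewrite /H0 /f.
under eq_integral do rewrite EFinM.
rewrite ge0_integralZl_EFin//.
- by move=> w _; rewrite lee_fin.
- apply/measurable_EFinP; apply: continuous_measurable_fun.
  exact: continuous_hfun_comp.
Qed.

Lemma calI_pcsa (R : realType) (q : R) : 1 < q ->
  calI (pcsa_I q) q = (I0 R * ((ln q)^-1)%:E)%E.
Proof.
move=> q1; have q0 : 0 < q by apply: lt_trans q1.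
have a0 : 0 < ln q by exact: ln_gt0.
pose f (w : R) := gfun (expR w).
have f0 w : 0 <= f w by rewrite gfun_ge0// expR_ge0.
have cf : continuous f by exact: continuous_gfun_comp.
have cfa : continuous (fun x => f (ln q * x)).
  move=> x; apply: (@continuous_comp _ _ _ (fun x => ln q * x) f); last exact: cf.
  by apply: cvgM; [exact: cvg_cst|exact: cvg_id].
rewrite /calI; under eq_integral => r _.
  (* At [lam = q ^ r] the weight [q ^ (2 r)] cancels the factor [1 / lam ^ 2] of the Fisher
     information. *)
  rewrite pcsa_IE ?powR_gt0// muleA -EFinM [2 * r]mulrC powRrM.
  rewrite powR_mulrn ?powR_ge0// divff ?mul1e; last by rewrite expf_neq0// gt_eqF// powR_gt0.
  under eq_esum => k _ do rewrite expR_ln_sub//.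
  over.
rewrite (integral_periodization (f := fun x => f (ln q * x)))// integral_scale//.
by rewrite muleC.
Qed.

(** * Series and logarithm *)

Lemma nneseries_cvg (R : realType) (f : nat -> R) (l : R) :
  series f x @[x --> \oo] --> l -> (\sum_(n <oo) (f n)%:E = l%:E)%E.
Proof.
move=> fl; rewrite (_ : (fun n => _) = EFin \o series f).
  by rewrite EFin_lim; [congr EFin; exact: cvg_lim|apply/cvg_ex; exists l].
by apply/funext => n; rewrite /= sumEFin.
Qed.

(** Beyond [N] the terms are at most differences of [v], whose sum [v N - v n] is at most [v N]
    because [v] is nonnegative. *)
Lemma nneseries_le_telescope (R : realType) (f v : nat -> R) (N : nat) :
  (forall n, 0 <= f n) -> (forall n, 0 <= v n) ->
  (forall n, (N <= n)%N -> f n <= v n - v n.+1) ->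
  (\sum_(n <oo) (f n)%:E <= (\sum_(n < N) f n + v N)%:E)%E.
Proof.
move=> f0 v0 fv.
apply: lime_le; first by apply: is_cvg_nneseries => n _ _; rewrite lee_fin.
exists N => // n /= Nn; rewrite sumEFin lee_fin (big_cat_nat (n := N))//=.
rewrite big_mkord lerD2l.
apply: (@le_trans _ _ (v N - v n)); last by rewrite gerBl.
rewrite -opprB -(telescope_sumr v Nn) -sumrN; apply: ler_sum_nat => k /andP[Nk _].
by rewrite opprB fv.
Qed.

(** The tail up to [n] is at least [u N - u n]; since [u] tends to 0, nothing is lost in the
    limit. *)
Lemma nneseries_ge_telescope (R : realType) (f u : nat -> R) (N : nat) :
  (forall n, 0 <= f n) -> u n @[n --> \oo] --> 0 ->
  (forall n, (N <= n)%N -> u n - u n.+1 <= f n) ->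
  ((\sum_(n < N) f n + u N)%:E <= \sum_(n <oo) (f n)%:E)%E.
Proof.
move=> f0 u0 fu.
have cu : (fun n => (\sum_(n < N) f n + (u N - u n))%:E) x @[x --> \oo] -->
    (\sum_(n < N) f n + u N)%:E.
  apply: cvg_EFin; first exact: nearW.
  apply: cvgD; first exact: cvg_cst.
  rewrite -[X in _ --> X]subr0; apply: cvgB => //; exact: cvg_cst.
rewrite -(cvg_lim _ cu)//; apply: lee_lim.
- by apply/cvg_ex; exists (\sum_(n < N) f n + u N)%:E.
- by apply: is_cvg_nneseries => n _ _; rewrite lee_fin.
exists N => // n /= Nn; rewrite sumEFin lee_fin (big_cat_nat (n := N))//=.
rewrite big_mkord lerD2l -opprB -(telescope_sumr u Nn) -sumrN.
by apply: ler_sum_nat => k /andP[Nk _]; rewrite opprB fu.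
Qed.

(** The derivative is the finite geometric sum of the [x ^ k], in closed form. *)
Lemma is_derive_sum_pow (R : realType) (n : nat) (x : R) : x != 1 ->
  is_derive x 1 (fun t => \sum_(k < n) t ^+ k.+1 / k.+1%:R)
    ((1 - x ^+ n) / (1 - x)).
Proof.
move=> x1; have nx : 1 - x != 0 by rewrite subr_eq0 eq_sym.
elim: n => [|n IHn].
  rewrite expr0 subrr mul0r.
  rewrite (_ : (fun _ => _) = cst 0); last by apply/funext => t; rewrite big_ord0.
  exact: is_derive_cst.
rewrite (_ : (fun _ => _) = (fun t => \sum_(k < n) t ^+ k.+1 / k.+1%:R) +
    n.+1%:R^-1 \*: (id ^+ n.+1)); last first.
  apply/funext => t; rewrite big_ord_recr/=; congr (_ + _).
  by rewrite fctE/= mulrC.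
apply: is_derive_eq.
rewrite /= /GRing.scale/= mulr1 mulrA mulVf ?pnatr_eq0// mul1r exprS.
by field.
Qed.

(** The remainder [D] vanishes at 0 and has derivative [t ^ n / (1 - t)], which on [[0, z]] lies
    between 0 and [t ^ n / (1 - z)]. Comparing monotone functions replaces an integral form of the
    remainder. *)
Lemma ln_taylor_bounds (R : realType) (n : nat) (z : R) : 0 <= z < 1 ->
  0 <= - ln (1 - z) - \sum_(k < n) z ^+ k.+1 / k.+1%:R
    <= z ^+ n.+1 / (n.+1%:R * (1 - z)).
Proof.
move=> /andP[z0 z1].
pose P (t : R) := \sum_(k < n) t ^+ k.+1 / k.+1%:R.
pose D (t : R) := - ln (1 - t) - P t.
have dD (t : R) : t < 1 -> is_derive t 1 D (t ^+ n / (1 - t)).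
  move=> t1; have t1' : 0 < 1 - t by rewrite subr_gt0.
  have dl : is_derive t 1 (fun t => ln (1 - t)) (- (1 - t)^-1).
    have d1 : is_derive t 1 (cst 1 - id : R -> R) (- 1).
      by apply: is_derive_eq; rewrite sub0r.
    have := @is_derive1_comp R (@ln R) (cst 1 - id) t _ _ (is_derive1_ln t1') d1.
    by rewrite mulrN1.
  have dP := @is_derive_sum_pow R n t (negbT (lt_eqF t1)).
  apply: (@is_derive_eq _ _ _ (- (fun t => ln (1 - t)) - P)).
  by rewrite opprK; field; rewrite lt0r_neq0.
have cD : {within `[0, z], continuous D}.
  apply: derivable_within_continuous => t; rewrite in_itv/= => /andP[_ tz].
  by have [] := dD _ (le_lt_trans tz z1).
have P0 : P 0 = 0.
  by rewrite /P big1// => i _; rewrite expr0n mul0r.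
have D0 : D 0 = 0 by rewrite /D P0 !subr0 ln1 oppr0.
apply/andP; split.
  rewrite -/(P z) -/(D z) -D0.
  apply: (@ger0_derive1_ndecr R D 0 z) => // t; rewrite in_itv/= => /andP[t0 tz].
    by have [] := dD _ (lt_trans tz z1).
  have dDt := dD _ (lt_trans tz z1).
  rewrite derive1E derive_val divr_ge0 ?exprn_ge0 ?(ltW t0)//.
  by rewrite subr_ge0 ltW// (lt_trans tz).
pose c := (1 - z)^-1.
(* The first summand is the antiderivative of the upper bound [c * t ^ n], so [U] is nondecreasing
   on [[0, z]]. *)
pose U := (c / n.+1%:R) \*: (id ^+ n.+1) - D : R -> R.
have dU (t : R) : t < 1 -> is_derive t 1 U (c * t ^+ n - t ^+ n / (1 - t)).
  move=> t1; have dDt := dD _ t1; apply: is_derive_eq.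
  by rewrite /= /GRing.scale/= mulr1 mulrA divfK ?pnatr_eq0.
have cU : {within `[0, z], continuous U}.
  apply: derivable_within_continuous => t; rewrite in_itv/= => /andP[_ tz].
  by have [] := dU _ (le_lt_trans tz z1).
have : U 0 <= U z.
  apply: (@ger0_derive1_ndecr R U 0 z _ _ cU 0 z (lexx _) z0 (lexx _)) => t;
    rewrite in_itv/= => /andP[t0 tz].
    by have [] := dU _ (lt_trans tz z1).
  have dUt := dU _ (lt_trans tz z1).
  rewrite derive1E derive_val subr_ge0 mulrC ler_wpM2r ?exprn_ge0 ?(ltW t0)//.
  rewrite lef_pV2 ?posrE ?subr_gt0// ?(lt_trans tz)//.
  by rewrite lerD2l lerN2 ltW.
rewrite /U !fctE/= D0 expr0n/= scaler0 subr0 subr_ge0.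
rewrite /D /P => /le_trans; apply.
by rewrite /GRing.scale/= /c invfM mulrC [X in _ <= _ * X]mulrC.
Qed.

Lemma ln_natSS_ge (R : realType) (n : nat) : ln (n.+1%:R : R) <= ln n.+2%:R.
Proof. by rewrite ler_ln ?posrE// ler_nat. Qed.

(** * Series for H0 and I0 *)

(* Frullani: writing the difference as \int_a^b phi (w + t) dt and exchanging the
   integrals, the inner integral over w no longer depends on t. *)
Lemma integral_shift_difference (R : realType) (phi Phi : R -> R)
    (l l' a b : R) : a <= b ->
  (forall x, 0 <= phi x) -> continuous phi ->
  (forall x : R, is_derive x 1 Phi (phi x)) ->
  Phi x @[x --> -oo] --> l -> Phi x @[x --> +oo] --> l' ->
  (\int[mu]_w (Phi (w + b) - Phi (w + a))%:E = ((l' - l) * (b - a))%:E)%E.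
Proof.
rewrite le_eqVlt => /predU1P[->|ab] phi0 cphi dPhi Phil Phil'.
  rewrite subrr mulr0; apply: integral0_eq => w _.
  by rewrite subrr.
(* The indicator extends the integral over [[a, b]] to the whole line, so that Tonelli applies on
   the plane. *)
pose F (p : R * R) := (phi (p.1 + p.2) * \1_(`[a, b]%classic) p.2)%:E.
have mF : measurable_fun setT F.
  apply/measurable_EFinP; apply: measurable_funM.
    apply: measurableT_comp; first exact: continuous_measurable_fun.
    by apply: measurable_funD; [exact: measurable_fst|exact: measurable_snd].
  by apply: measurableT_comp; [exact: measurable_indic|exact: measurable_snd].
have F0 p : (0 <= F p)%E by rewrite lee_fin mulr_ge0.
have cPhi := is_derive1_continuous dPhi.
have cPsh w := continuous_comp_shift (c := w) cPhi.
transitivity (\int[mu]_w \int[mu]_t F (w, t))%E.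
  apply: eq_integral => w _; apply/esym.
  transitivity (\int[mu]_(t in `[a, b]) (phi (t + w))%:E)%E.
    rewrite [RHS]integral_mkcond; apply: eq_integral => t _.
    rewrite /F/= patchE indicE addrC.
    by case: (t \in _); rewrite /= ?mulr1 ?mulr0.
  rewrite (@continuous_FTC2 R _ (fun t => Phi (t + w)))//.
  - by rewrite -EFinB [b + w]addrC [a + w]addrC.
  - exact/continuous_subspaceT/continuous_comp_shift.
  - split; first by move=> t _; have [] := is_derive1_shift w t dPhi.
      by apply: cvg_at_right_filter; exact: cPsh.
    by apply: cvg_at_left_filter; exact: cPsh.
  - by move=> t _; rewrite derive1E; have dt := is_derive1_shift w t dPhi; exact: derive_val.
rewrite fubini_tonelli//.
transitivity (\int[mu]_(t in `[a, b]) (cst (l' - l)%:E t))%E.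
  rewrite [RHS]integral_mkcond; apply: eq_integral => t _.
  rewrite patchE /F/= indicE; case: (t \in _); last first.
    by under eq_integral do rewrite mulr0; rewrite integral0.
  under eq_integral do rewrite mulr1.
  exact: (ge0_continuous_FTC2T_shift _ phi0 cphi dPhi Phil Phil').
by rewrite integral_cst//= lebesgue_measure_itv/= lte_fin ab -EFinD -EFinM.
Qed.

(** * Antiderivatives behind the termwise integrals *)

Lemma cvg_expRy (R : realType) : expR x @[x --> +oo] --> (+oo : set_system R).
Proof.
apply/cvgryPge => A; near=> x.
apply: (@le_trans _ _ x); first by near: x; apply: nbhs_pinfty_ge; exact: num_real.
by apply: le_trans (expR_ge1Dx x); rewrite lerDr.
Unshelve. all: by end_near. Qed.

Lemma cvg_expRNy (R : realType) : expR x @[x --> -oo] --> (0 : R).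
Proof.
apply/cvgNy_compNP; exact: cvgr_expR.
Qed.

Lemma cvgNy_gompertz (R : realType) :
  - expR (- expR x) @[x --> -oo] --> (- 1 : R).
Proof.
apply: cvgN; rewrite -[X in _ --> X](@expR0 R) -oppr0.
apply: (@cvg_comp _ _ _ (fun x : R => - expR x) expR); last exact: continuous_expR.
by apply: cvgN; exact: cvg_expRNy.
Qed.

Lemma cvgy_gompertz (R : realType) :
  - expR (- expR x) @[x --> +oo] --> (0 : R).
Proof.
rewrite -[X in _ --> X]oppr0; apply: cvgN.
exact: cvg_comp (@cvg_expRy R) (@cvgr_expR R).
Qed.

(** Under [y = e ^ w] this is the primitive [- e ^ (- y)] of [e ^ (- y)]; its limits -1 and 0 give
    total mass 1. *)
Lemma is_derive_gompertz (R : realType) (x : R) :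
  is_derive x 1 (fun w => - expR (- expR w)) (expR x * expR (- expR x)).
Proof.
have d1 : is_derive x 1 (fun w => - expR w) (- expR x).
  exact: (@is_deriveN _ _ _ expR).
have d2 := @is_derive1_comp R expR (fun w => - expR w) x _ _ (is_derive_expR _) d1.
have d3 := is_deriveN d2.
by rewrite mulrN opprK mulrC in d3.
Qed.

Lemma continuous_expR_pow_gompertz (R : realType) (n : nat) :
  continuous (fun w : R => expR w ^+ n * expR (- expR w)).
Proof.
have ce := @continuous_expR R.
move=> w; apply: cvgM.
  by apply: (@continuous_comp _ _ _ expR (fun y => y ^+ n));
    [exact: ce|exact: exprn_continuous].
apply: (@continuous_comp _ _ _ (fun w => - expR w) expR); last exact: ce.
by apply: continuousN; exact: ce.
Qed.

(** Under [y = e ^ w] the integrand becomes [y e ^ (- y)], whose integral over the positive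
    half-line is [Gamma(2) = 1]. *)
Lemma is_derive_gamma2 (R : realType) (x : R) :
  is_derive x 1 (fun w => - expR (- expR w) * (1 + expR w))
    (expR x ^+ 2 * expR (- expR x)).
Proof.
have d1 := is_derive_gompertz x.
have d2 : is_derive x 1 (cst 1 + expR) (expR x).
  by apply: is_derive_eq; rewrite add0r.
apply: (@is_derive_eq _ _ _ ((fun w => - expR (- expR w)) * (cst 1 + expR))).
by rewrite /GRing.scale/= !fctE/=; ring.
Qed.

Lemma cvgNy_gamma2 (R : realType) :
  - expR (- expR x) * (1 + expR x) @[x --> -oo] --> (- 1 : R).
Proof.
have -> : - 1 = - 1 * (1 + 0) :> R by rewrite addr0 mulr1.
apply: cvgM; first exact: cvgNy_gompertz.
by apply: cvgD; [exact: cvg_cst|exact: cvg_expRNy].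
Qed.

Lemma cvgy_gamma2 (R : realType) :
  - expR (- expR x) * (1 + expR x) @[x --> +oo] --> (0 : R).
Proof.
(* The comparison function comes from [1 + y <= 2 (1 + y / 2) <= 2 e ^ (y / 2)], which gives
   [e ^ (- y) (1 + y) <= 2 e ^ (- y / 2)]. *)
have h : - (2 * expR (- (2^-1 * x))) @[x --> +oo] --> (0 : R).
  rewrite -[X in _ --> X]oppr0; apply: cvgN.
  rewrite -[X in _ --> X](@mulr0 R 2); apply: cvgM; first exact: cvg_cst.
  apply: cvg_comp (@cvgr_expR R); apply: gt0_cvgMry => //; exact: cvg_id.
apply: (@squeeze_cvgr _ _ _ _ (fun x => - (2 * expR (- (2^-1 * expR x)))) (cst 0)).
- apply: nearW => x; apply/andP; split; last first.
    by rewrite mulNr oppr_le0 mulr_ge0 ?expR_ge0// addr_ge0// expR_ge0.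
  rewrite mulNr lerN2; set y := expR x.
  have -> : expR (- y) = expR (- (2^-1 * y)) * expR (- (2^-1 * y)).
    by rewrite -expRD; congr expR; lra.
  rewrite -mulrA [2 * _]mulrC ler_wpM2l ?expR_ge0//.
  rewrite expRN mulrC ler_pdivrMr ?expR_gt0//.
  have := expR_ge1Dx (2^-1 * y); lra.
- exact: cvg_comp (@cvg_expRy R) h.
- exact: cvg_cst.
Qed.

(** This is the geometric expansion of [1 / (e ^ x - 1)]. Adding [ln n.+1] to [w] multiplies [x] by
    [n.+1], so every term is a weighted translate of one function. *)
Lemma nneseries_gfun (R : realType) (w : R) :
  (\sum_(n <oo) ((n.+1%:R ^+ 2)^-1 *
    (expR (w + ln n.+1%:R) ^+ 2 * expR (- expR (w + ln n.+1%:R))))%:E =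
   (gfun (expR w))%:E)%E.
Proof.
set x := expR w; have x0 : 0 < x by exact: expR_gt0.
pose z := expR (- x).
have z0 : 0 < z by exact: expR_gt0.
have z1 : z < 1 by rewrite expR_lt1 oppr_lt0.
transitivity (\sum_(n <oo) (geometric (x ^+ 2 * z) z n)%:E)%E.
  apply: eq_eseriesr => n _; congr EFin.
  rewrite expRD lnK ?posrE// -/x.
  have -> : expR (- (x * n.+1%:R)) = z ^+ n.+1 by rewrite -expRM_natr mulNr.
  rewrite /geometric/= [z ^+ n.+1]exprS.
  have : (n.+1%:R : R) != 0 by rewrite pnatr_eq0.
  by move: (n.+1%:R : R) => m m0; field.
have -> : gfun x = x ^+ 2 * z / (1 - z).
  have e1 : expR x - 1 != 0 by rewrite subr_eq0 gt_eqF// expR_gt1.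
  rewrite /gfun /z expRN; field; rewrite e1 gt_eqF ?expR_gt0//=.
apply: nneseries_cvg; apply: cvg_geometric_series.
by rewrite ger0_norm ?ltW.
Qed.

(** Each translate integrates to [Gamma(2) = 1], so only the weights remain. *)
Lemma I0E (R : realType) : I0 R = (\sum_(n <oo) ((n.+1%:R ^+ 2)^-1)%:E)%E.
Proof.
pose psi (w : R) := expR w ^+ 2 * expR (- expR w).
have cpsi : continuous psi by exact: continuous_expR_pow_gompertz.
have psi0 w : 0 <= psi w by rewrite mulr_ge0 ?exprn_ge0 ?expR_ge0.
have mpsi n : measurable_fun setT (fun w : R => (psi (w + ln n.+1%:R))%:E).
  apply/measurable_EFinP; apply: continuous_measurable_fun.
  exact: continuous_comp_shift.
rewrite /I0; under eq_integral do rewrite -nneseries_gfun.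
rewrite integral_nneseries//; last first.
- move=> n; under eq_fun do rewrite EFinM.
  by apply: measurable_funeM; exact: mpsi.
apply: eq_eseriesr => n _; under eq_integral do rewrite EFinM.
rewrite (@ge0_integralZl_EFin _ _ _ mu _ measurableT _ _ (mpsi n))//; last first.
  by move=> w _; rewrite lee_fin; exact: psi0.
rewrite (ge0_continuous_FTC2T_shift _ psi0 cpsi (@is_derive_gamma2 R)
  (@cvgNy_gamma2 R) (@cvgy_gamma2 R)).
by rewrite sub0r opprK mule1.
Qed.

(** With [z = e ^ (- x)], the part [- z ln z] is [x z], and [- (1 - z) ln (1 - z)] expands into
    [(z ^ n.+1 - z ^ n.+2) / n.+1]. Since [z ^ n.+1] is [- Phi (w + ln n.+1)], these are differences
    of Frullani type. *)
Lemma nneseries_hfun (R : realType) (w : R) (Phi := fun w : R => - expR (- expR w)) :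
  (hfun (expR (- expR w)))%:E =
  ((expR w * expR (- expR w))%:E + \sum_(n <oo)
    (n.+1%:R^-1 * (Phi (w + ln n.+2%:R) - Phi (w + ln n.+1%:R)))%:E)%E.
Proof.
set x := expR w; have x0 : 0 < x by exact: expR_gt0.
pose z := expR (- x).
have z0 : 0 < z by exact: expR_gt0.
have z1 : z < 1 by rewrite expR_lt1 oppr_lt0.
have z1' : 0 < 1 - z by rewrite subr_gt0.
rewrite (@nneseries_cvg _ _ (- ((1 - z) * ln (1 - z)))).
  by rewrite -EFinD /hfun -/z expRK; congr EFin; ring.
have PhiE n : Phi (w + ln n.+1%:R) = - z ^+ n.+1.
  by rewrite /Phi expRD lnK ?posrE// -/x -expRM_natr mulNr.
rewrite (_ : series _ = (fun n =>
    (1 - z) * \sum_(k < n) z ^+ k.+1 / k.+1%:R)); last first.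
  apply/funext => n; rewrite /series/= big_mkord mulr_sumr.
  by apply: eq_bigr => k _; rewrite !PhiE [z ^+ k.+2]exprS; ring.
rewrite -mulrN; apply: cvgM; first exact: cvg_cst.
(* A geometric bound [z ^ n.+1 / (1 - z)] on the Taylor remainder, obtained by dropping its factor
   [1 / n.+1]. *)
pose g n := geometric (z / (1 - z)) z n.
have gc : g n @[n --> \oo] --> 0.
  by apply: cvg_geometric; rewrite ger0_norm ?ltW.
have hc : - ln (1 - z) - g n @[n --> \oo] --> - ln (1 - z).
  by rewrite -[X in _ --> X]subr0; apply: cvgB => //; exact: cvg_cst.
apply: (squeeze_cvgr _ hc); last exact: cvg_cst.
apply: nearW => n; have z01 : 0 <= z < 1 by rewrite ltW.
have /andP[] := @ln_taylor_bounds R n z z01.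
rewrite subr_ge0 => h1 h2; rewrite h1 andbT lerBlDr -lerBlDl.
apply: (le_trans h2); rewrite /g /geometric/=.
have c0 : 0 <= z ^+ n.+1 / (1 - z) by rewrite divr_ge0 ?exprn_ge0 ?ltW.
have -> : z / (1 - z) * z ^+ n = z ^+ n.+1 / (1 - z) by rewrite exprS mulrAC.
by rewrite invfM mulrCA ler_piMl// invf_le1 ?ler1n.
Qed.

Lemma H0E (R : realType) :
  H0 R = ((ln 2)^-1%:E *
    (1 + \sum_(n <oo) (n.+1%:R^-1 * (ln n.+2%:R - ln n.+1%:R))%:E))%E.
Proof.
pose Phi (w : R) := - expR (- expR w).
pose phi (w : R) := expR w * expR (- expR w).
have cphi : continuous phi.
  exact: (@continuous_expR_pow_gompertz R 1).
have phi0 w : 0 <= phi w by rewrite mulr_ge0 ?expR_ge0.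
have cPhi : continuous Phi := is_derive1_continuous (@is_derive_gompertz R).
pose D n (w : R) := Phi (w + ln n.+2%:R) - Phi (w + ln n.+1%:R).
have D0 n w : 0 <= D n w.
  by rewrite subr_ge0 lerN2 ler_expR lerN2 ler_expR lerD2l ln_natSS_ge.
have mD n : measurable_fun setT (fun w : R => (D n w)%:E).
  apply/measurable_EFinP; apply: continuous_measurable_fun => w.
  by apply: cvgB; exact: continuous_comp_shift.
have mnD n : measurable_fun setT (fun w : R => (n.+1%:R^-1 * D n w)%:E).
  under eq_fun do rewrite EFinM.
  by apply: measurable_funeM; exact: mD.
have nD0 n w : (0 <= (n.+1%:R^-1 * D n w)%:E)%E by rewrite lee_fin mulr_ge0.
rewrite /H0; congr (_ * _)%E; under eq_integral do rewrite nneseries_hfun.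
rewrite ge0_integralD//=; last 3 first.
- by apply/measurable_EFinP; exact: continuous_measurable_fun.
- by move=> w _; apply: nneseries_ge0 => n _ _; exact: nD0.
- apply: ge0_emeasurable_sum => [n w _ _|n _]; [exact: nD0|exact: mnD].
congr (_ + _)%E.
  transitivity ((0 - -1 : R)%:E); last by rewrite sub0r opprK.
  exact: (ge0_continuous_FTC2T phi0 cphi (@is_derive_gompertz R)
    (@cvgNy_gompertz R) (@cvgy_gompertz R)).
rewrite integral_nneseries//; last by move=> n w _; exact: nD0.
apply: eq_eseriesr => n _; under eq_integral do rewrite EFinM.
rewrite (@ge0_integralZl_EFin _ _ _ mu _ measurableT _ _ (mD n))//; last first.
  by move=> w _; rewrite lee_fin; exact: D0.
rewrite EFinM; congr (_ * _)%E.
(* [Phi] increases from -1 to 0, so each Frullani integral is exactly the difference of the two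
   shifts. *)
have := integral_shift_difference (ln_natSS_ge R n) phi0 cphi
  (@is_derive_gompertz R) (@cvgNy_gompertz R) (@cvgy_gompertz R).
by rewrite sub0r opprK mul1r.
Qed.

(** * Numerical enclosures *)

(** Since [1 - z = x / (x + 1)], the difference of logarithms is [- ln (1 - z)]. *)
Lemma lnS_sub_bounds (R : realType) (n : nat) (x : R) (z := (x + 1)^-1) :
  0 < x ->
  \sum_(k < n) z ^+ k.+1 / k.+1%:R <= ln (x + 1) - ln x
    <= \sum_(k < n) z ^+ k.+1 / k.+1%:R + z ^+ n.+1 / (n.+1%:R * (1 - z)).
Proof.
move=> x0; have x1 : 0 < x + 1 by rewrite addr_gt0.
have z01 : 0 <= z < 1.
  by rewrite invr_ge0 ltW//= invf_lt1// ltrDr.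
have -> : ln (x + 1) - ln x = - ln (1 - z).
  have -> : 1 - z = x / (x + 1) by rewrite /z; field; rewrite lt0r_neq0.
  by rewrite ln_div ?posrE// opprB.
have /andP[h1 h2] := @ln_taylor_bounds R n z z01.
by rewrite -lerBDl h2 andbT -subr_ge0.
Qed.

Definition log_term (R : realType) (n : nat) : R :=
  n.+1%:R^-1 * (ln n.+2%:R - ln n.+1%:R).

Lemma log_term_ge0 (R : realType) n : 0 <= log_term R n.
Proof. by rewrite mulr_ge0 ?invr_ge0// subr_ge0 ln_natSS_ge. Qed.

(** The expansion, through order 3 in [1 / x], of the sum of [ln (1 + 1 / m) / m] over
    [m = x, x + 1, ...]. *)
Definition log_tail (R : realType) (x : R) : R :=
  x^-1 + (4 * x ^+ 2)^-1 + (36 * x ^+ 3)^-1.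

(** Four Taylor terms and their remainder reduce the claim to the sign of a rational function. *)
Lemma log_tail_upper (R : realType) (x : R) : 8 <= x ->
  x^-1 * (ln (x + 1) - ln x) <= log_tail x - log_tail (x + 1).
Proof.
move=> x8; have x0 : 0 < x by lra.
have /andP[_ h] := @lnS_sub_bounds R 4 x x0.
apply: le_trans (ler_wpM2l _ h) _; first by rewrite invr_ge0 ltW.
rewrite -subr_ge0 !big_ord_recr big_ord0/= /log_tail.
(* After the shift x = t + 8 the numerator has nonnegative coefficients. *)
have [t t0 ->] : exists2 t, 0 <= t & x = t + 8.
  by exists (x - 8); [lra|ring].
rewrite [X in 0 <= X](_ : _ = (1197 + 269 * t + 15 * t ^+ 2) /
    (180 * (t + 8) ^+ 3 * (t + 9) ^+ 4)).
  apply: divr_ge0.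
    by have := exprn_ge0 2 t0; have := exprn_ge0 3 t0; lra.
  apply: mulr_ge0; last by apply: exprn_ge0; lra.
  by apply: mulr_ge0; [lra|apply: exprn_ge0; lra].
by field; do ?[apply/andP; split]; rewrite lt0r_neq0//; lra.
Qed.

(** The next term of the expansion is [- 1 / (48 x ^ 4)]; doubling it leaves room for the discarded
    Taylor remainder. *)
Lemma log_tail_lower (R : realType) (x : R)
    (u := fun x => log_tail x - (24 * x ^+ 4)^-1) :
  8 <= x -> u x - u (x + 1) <= x^-1 * (ln (x + 1) - ln x).
Proof.
move=> x8; have x0 : 0 < x by lra.
have /andP[h _] := @lnS_sub_bounds R 4 x x0.
apply: le_trans (ler_wpM2l _ h); last by rewrite invr_ge0 ltW.
rewrite -subr_ge0 !big_ord_recr big_ord0/= /u /log_tail.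
have [t t0 ->] : exists2 t, 0 <= t & x = t + 8.
  by exists (x - 8); [lra|ring].
rewrite [X in 0 <= X](_ : _ = (2643 + 1034 * t + 136 * t ^+ 2 + 6 * t ^+ 3) /
    (72 * (t + 8) ^+ 4 * (t + 9) ^+ 4)).
  apply: divr_ge0.
    by have := exprn_ge0 2 t0; have := exprn_ge0 3 t0; lra.
  apply: mulr_ge0; last by apply: exprn_ge0; lra.
  by apply: mulr_ge0; [lra|apply: exprn_ge0; lra].
by field; do ?[apply/andP; split]; rewrite lt0r_neq0//; lra.
Qed.

(** The Euler-Maclaurin expansion of the sum of [1 / m ^ 2] over [m = x, x + 1, ...]; the term that
    follows is [- 1 / (30 x ^ 5)]. *)
Definition zeta2_tail (R : realType) (x : R) : R :=
  x^-1 + (2 * x ^+ 2)^-1 + (6 * x ^+ 3)^-1.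

(** The gap between the two sides is exactly [1 / (6 x ^ 3 (x + 1) ^ 3)]. *)
Lemma zeta2_tail_upper (R : realType) (x : R) : 8 <= x ->
  (x ^+ 2)^-1 <= zeta2_tail x - zeta2_tail (x + 1).
Proof.
move=> x8; rewrite -subr_ge0 /zeta2_tail.
have [t t0 ->] : exists2 t, 0 <= t & x = t + 8.
  by exists (x - 8); [lra|ring].
rewrite [X in 0 <= X](_ : _ = 1 / (6 * (t + 8) ^+ 3 * (t + 9) ^+ 3)).
  apply: divr_ge0.
    by have := exprn_ge0 2 t0; have := exprn_ge0 3 t0; lra.
  apply: mulr_ge0; last by apply: exprn_ge0; lra.
  by apply: mulr_ge0; [lra|apply: exprn_ge0; lra].
by field; do ?[apply/andP; split]; rewrite lt0r_neq0//; lra.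
Qed.

Lemma zeta2_tail_lower (R : realType) (x : R)
    (u := fun x => zeta2_tail x - (30 * x ^+ 5)^-1) :
  8 <= x -> u x - u (x + 1) <= (x ^+ 2)^-1.
Proof.
move=> x8; rewrite -subr_ge0 /u /zeta2_tail.
have [t t0 ->] : exists2 t, 0 <= t & x = t + 8.
  by exists (x - 8); [lra|ring].
rewrite [X in 0 <= X](_ : _ = (361 + 85 * t + 5 * t ^+ 2) /
    (30 * (t + 8) ^+ 5 * (t + 9) ^+ 5)).
  apply: divr_ge0.
    by have := exprn_ge0 2 t0; have := exprn_ge0 3 t0; lra.
  apply: mulr_ge0; last by apply: exprn_ge0; lra.
  by apply: mulr_ge0; [lra|apply: exprn_ge0; lra].
by field; do ?[apply/andP; split]; rewrite lt0r_neq0//; lra.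
Qed.

(** The identity [1 - z = k.+1 z] rewrites the remainder so that both side conditions are purely
    rational. *)
Lemma ln_ratio_encl (R : realType) (k n : nat) (lo hi : R) (z := k.+2%:R^-1 : R) :
  lo <= \sum_(i < n) z ^+ i.+1 / i.+1%:R ->
  \sum_(i < n) z ^+ i.+1 / i.+1%:R + z ^+ n / n.+1%:R / k.+1%:R <= hi ->
  lo <= ln k.+2%:R - ln k.+1%:R <= hi.
Proof.
move=> hlo hhi; have /andP[h1 h2] := @lnS_sub_bounds R n k.+1%:R (ltr0Sn _ _).
move: h1 h2; rewrite natr1 -/z => h1 h2.
rewrite (le_trans hlo h1) (le_trans h2)//.
suff -> : z ^+ n.+1 / (n.+1%:R * (1 - z)) = z ^+ n / n.+1%:R / k.+1%:R by [].
have -> : 1 - z = k.+1%:R * z.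
  by rewrite -[k.+1%:R](addrK 1) natr1 mulrBl mul1r divff// pnatr_eq0.
rewrite exprSr; have z0 : z != 0 by rewrite invr_eq0 pnatr_eq0.
have n0 : (n.+1%:R : R) != 0 by rewrite pnatr_eq0.
have k0 : (k.+1%:R : R) != 0 by rewrite pnatr_eq0.
by move: (n.+1%:R : R) (k.+1%:R : R) n0 k0 => m p m0 p0; field; rewrite p0 m0.
Qed.

(* Decimals are split into small literals: ring numerals are unary naturals. *)
Lemma ln_ratio_encl0 (R : realType) :
  (693 / 10 ^+ 3 + 147 / 10 ^+ 6 + 17 / 10 ^+ 8) <= ln (2%:R : R) - ln (1%:R : R)
    <= 693 / 10 ^+ 3 + 147 / 10 ^+ 6 + 19 / 10 ^+ 8.
(* With [z = 1 / 2], 22 terms bring the remainder [2 ^ (- 22) / 23] down to about [10 ^ (- 8)]. The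
   later ratios have smaller [z] and need fewer terms. *)
Proof. by apply: (@ln_ratio_encl R 0 22); rewrite !big_ord_recr big_ord0/=; lra. Qed.

Lemma ln_ratio_encl1 (R : realType) :
  (405 / 10 ^+ 3 + 465 / 10 ^+ 6 + 10 / 10 ^+ 8) <= ln (3%:R : R) - ln (2%:R : R)
    <= 405 / 10 ^+ 3 + 465 / 10 ^+ 6 + 11 / 10 ^+ 8.
Proof. by apply: (@ln_ratio_encl R 1 14); rewrite !big_ord_recr big_ord0/=; lra. Qed.

Lemma ln_ratio_encl2 (R : realType) :
  (287 / 10 ^+ 3 + 682 / 10 ^+ 6 + 6 / 10 ^+ 8) <= ln (4%:R : R) - ln (3%:R : R)
    <= 287 / 10 ^+ 3 + 682 / 10 ^+ 6 + 8 / 10 ^+ 8.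
Proof. by apply: (@ln_ratio_encl R 2 11); rewrite !big_ord_recr big_ord0/=; lra. Qed.

Lemma ln_ratio_encl3 (R : realType) :
  (223 / 10 ^+ 3 + 143 / 10 ^+ 6 + 53 / 10 ^+ 8) <= ln (5%:R : R) - ln (4%:R : R)
    <= 223 / 10 ^+ 3 + 143 / 10 ^+ 6 + 56 / 10 ^+ 8.
Proof. by apply: (@ln_ratio_encl R 3 9); rewrite !big_ord_recr big_ord0/=; lra. Qed.

Lemma ln_ratio_encl4 (R : realType) :
  (182 / 10 ^+ 3 + 321 / 10 ^+ 6 + 54 / 10 ^+ 8) <= ln (6%:R : R) - ln (5%:R : R)
    <= 182 / 10 ^+ 3 + 321 / 10 ^+ 6 + 56 / 10 ^+ 8.
Proof. by apply: (@ln_ratio_encl R 4 8); rewrite !big_ord_recr big_ord0/=; lra. Qed.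

Lemma ln_ratio_encl5 (R : realType) :
  (154 / 10 ^+ 3 + 150 / 10 ^+ 6 + 67 / 10 ^+ 8) <= ln (7%:R : R) - ln (6%:R : R)
    <= 154 / 10 ^+ 3 + 150 / 10 ^+ 6 + 68 / 10 ^+ 8.
Proof. by apply: (@ln_ratio_encl R 5 8); rewrite !big_ord_recr big_ord0/=; lra. Qed.

Lemma ln_ratio_encl6 (R : realType) :
  (133 / 10 ^+ 3 + 531 / 10 ^+ 6 + 38 / 10 ^+ 8) <= ln (8%:R : R) - ln (7%:R : R)
    <= 133 / 10 ^+ 3 + 531 / 10 ^+ 6 + 40 / 10 ^+ 8.
Proof. by apply: (@ln_ratio_encl R 6 7); rewrite !big_ord_recr big_ord0/=; lra. Qed.

Lemma ln_ratio_encl7 (R : realType) :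
  (117 / 10 ^+ 3 + 783 / 10 ^+ 6 + 3 / 10 ^+ 8) <= ln (9%:R : R) - ln (8%:R : R)
    <= 117 / 10 ^+ 3 + 783 / 10 ^+ 6 + 4 / 10 ^+ 8.
Proof. by apply: (@ln_ratio_encl R 7 7); rewrite !big_ord_recr big_ord0/=; lra. Qed.

Lemma ln_ratio_encl8 (R : realType) :
  (105 / 10 ^+ 3 + 360 / 10 ^+ 6 + 50 / 10 ^+ 8) <= ln (10%:R : R) - ln (9%:R : R)
    <= 105 / 10 ^+ 3 + 360 / 10 ^+ 6 + 52 / 10 ^+ 8.
Proof. by apply: (@ln_ratio_encl R 8 6); rewrite !big_ord_recr big_ord0/=; lra. Qed.

Lemma ln_ratio_encl9 (R : realType) :
  (95 / 10 ^+ 3 + 310 / 10 ^+ 6 + 17 / 10 ^+ 8) <= ln (11%:R : R) - ln (10%:R : R)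
    <= 95 / 10 ^+ 3 + 310 / 10 ^+ 6 + 18 / 10 ^+ 8.
Proof. by apply: (@ln_ratio_encl R 9 6); rewrite !big_ord_recr big_ord0/=; lra. Qed.

Lemma ln_ratio_encl10 (R : realType) :
  (87 / 10 ^+ 3 + 11 / 10 ^+ 6 + 37 / 10 ^+ 8) <= ln (12%:R : R) - ln (11%:R : R)
    <= 87 / 10 ^+ 3 + 11 / 10 ^+ 6 + 38 / 10 ^+ 8.
Proof. by apply: (@ln_ratio_encl R 10 6); rewrite !big_ord_recr big_ord0/=; lra. Qed.

Lemma ln_ratio_encl11 (R : realType) :
  (80 / 10 ^+ 3 + 42 / 10 ^+ 6 + 70 / 10 ^+ 8) <= ln (13%:R : R) - ln (12%:R : R)
    <= 80 / 10 ^+ 3 + 42 / 10 ^+ 6 + 71 / 10 ^+ 8.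
Proof. by apply: (@ln_ratio_encl R 11 6); rewrite !big_ord_recr big_ord0/=; lra. Qed.

(** * Enclosures of the two series and of the quotient *)

Lemma cvg_div_natpow (R : realType) (a : R) (k : nat) :
  (a * n.+1%:R ^+ k.+1)^-1 @[n --> \oo] --> (0 : R).
Proof.
rewrite (_ : (fun n => _) = fun n : nat => a^-1 * (n.+1%:R^-1 * n.+1%:R^-1 ^+ k)); last first.
  by apply/funext => n; rewrite invfM -exprVn exprS.
rewrite -[X in _ --> X](@mulr0 R a^-1); apply: cvgM; first exact: cvg_cst.
have h : n.+1%:R^-1 @[n --> \oo] --> (0 : R) by exact: cvg_harmonic.
apply: (@squeeze_cvgr _ _ _ _ (cst 0) (fun n : nat => n.+1%:R^-1)) => //; last exact: cvg_cst.
apply: nearW => n; rewrite mulr_ge0 ?exprn_ge0 ?invr_ge0//=.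
by rewrite ler_piMr ?invr_ge0// exprn_ile1 ?invr_ge0// invf_le1 ?ler1n.
Qed.

(** The term of index [n] is the summand at [x = n.+1], so after 12 terms the tail starts at 13. *)
Lemma nneseries_log_term_encl (R : realType) :
  exists2 S : R, (\sum_(n <oo) (log_term R n)%:E = S%:E)%E &
    \sum_(n < 12) log_term R n + (log_tail 13 - (24 * 13 ^+ 4)^-1) <= S
      <= \sum_(n < 12) log_term R n + log_tail 13.
Proof.
have up := @nneseries_le_telescope R (log_term R)
  (fun n => log_tail n.+1%:R) 12 (@log_term_ge0 R).
have lo := @nneseries_ge_telescope R (log_term R)
  (fun n => log_tail n.+1%:R - (24 * n.+1%:R ^+ 4)^-1) 12 (@log_term_ge0 R).
have {}up := up _ _.
have n8 n : (12 <= n)%N -> 8 <= n.+1%:R :> R.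
  by move=> n12; rewrite ler_nat; exact: leq_trans (leqW n12).
have {}up : (\sum_(n <oo) (log_term R n)%:E <=
    (\sum_(n < 12) log_term R n + log_tail 13)%:E)%E.
  apply: up => [n|n /n8 h]; first by rewrite !addr_ge0 ?invr_ge0 ?mulr_ge0 ?exprn_ge0.
  by have := log_tail_upper h; rewrite natr1.
have {}lo : ((\sum_(n < 12) log_term R n + (log_tail 13 - (24 * 13 ^+ 4)^-1))%:E <=
    \sum_(n <oo) (log_term R n)%:E)%E.
  apply: lo => [|n /n8 h]; last by have := log_tail_lower h; rewrite natr1.
  rewrite -[X in _ --> X](subr0 0); apply: cvgB; last exact: cvg_div_natpow.
  rewrite -[X in _ --> X](addr0 0); apply: cvgD; last exact: cvg_div_natpow.
  rewrite -[X in _ --> X](addr0 0); apply: cvgD; last exact: cvg_div_natpow.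
  exact: cvg_harmonic.
(* The two real bounds rule out infinite values of the sum. *)
case: (\sum_(n <oo) _)%E lo up => [S||]//; rewrite !lee_fin => lo up.
by exists S => //; rewrite lo.
Qed.

Lemma nneseries_zeta2_encl (R : realType) (f := fun n => (n.+1%:R ^+ 2)^-1 : R) :
  exists2 B : R, (\sum_(n <oo) (f n)%:E = B%:E)%E &
    \sum_(n < 12) f n + (zeta2_tail 13 - (30 * 13 ^+ 5)^-1) <= B
      <= \sum_(n < 12) f n + zeta2_tail 13.
Proof.
have f0 n : 0 <= f n by rewrite invr_ge0 exprn_ge0.
have n8 n : (12 <= n)%N -> 8 <= n.+1%:R :> R.
  by move=> n12; rewrite ler_nat; exact: leq_trans (leqW n12).
have up : (\sum_(n <oo) (f n)%:E <= (\sum_(n < 12) f n + zeta2_tail 13)%:E)%E.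
  apply: (@nneseries_le_telescope R f (fun n => zeta2_tail n.+1%:R)) => // [n|n /n8 h].
    by rewrite !addr_ge0 ?invr_ge0 ?mulr_ge0 ?exprn_ge0.
  by have := zeta2_tail_upper h; rewrite natr1.
have lo : ((\sum_(n < 12) f n + (zeta2_tail 13 - (30 * 13 ^+ 5)^-1))%:E <=
    \sum_(n <oo) (f n)%:E)%E.
  apply: (@nneseries_ge_telescope R f
    (fun n => zeta2_tail n.+1%:R - (30 * n.+1%:R ^+ 5)^-1)) => // [|n /n8 h]; last first.
    by have := zeta2_tail_lower h; rewrite natr1.
  rewrite -[X in _ --> X](subr0 0); apply: cvgB; last exact: cvg_div_natpow.
  rewrite -[X in _ --> X](addr0 0); apply: cvgD; last exact: cvg_div_natpow.
  rewrite -[X in _ --> X](addr0 0); apply: cvgD; last exact: cvg_div_natpow.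
  exact: cvg_harmonic.
case: (\sum_(n <oo) _)%E lo up => [B||]//; rewrite !lee_fin => lo up.
by exists B => //; rewrite lo.
Qed.

(** The two bounds on the tail of [S] differ by [1 / (24 * 13 ^ 4)], about [1.5 / 10 ^ 6], which
    fits in the width [2 / 10 ^ 6] allowed for [S]. *)
Lemma H0_I0_values (R : realType) : exists S B : R,
  [/\ H0 R = ((ln 2)^-1 * (1 + S))%:E, I0 R = B%:E,
    1 + 257 / 10 ^+ 3 + 746 / 10 ^+ 6 <= S <= 1 + 257 / 10 ^+ 3 + 748 / 10 ^+ 6 &
    1 + 644 / 10 ^+ 3 + 934 / 10 ^+ 6 <= B <= 1 + 644 / 10 ^+ 3 + 935 / 10 ^+ 6].
Proof.
have [S SE Sb] := nneseries_log_term_encl R.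
have [B BE Bb] := nneseries_zeta2_encl R.
exists S, B; split.
- by rewrite H0E -/(log_term R) SE.
- by rewrite I0E BE.
- move: Sb; rewrite !big_ord_recr big_ord0 /= /log_term /log_tail.
  have := ln_ratio_encl0 R; have := ln_ratio_encl1 R; have := ln_ratio_encl2 R.
  have := ln_ratio_encl3 R; have := ln_ratio_encl4 R; have := ln_ratio_encl5 R.
  have := ln_ratio_encl6 R; have := ln_ratio_encl7 R; have := ln_ratio_encl8 R.
  have := ln_ratio_encl9 R; have := ln_ratio_encl10 R; have := ln_ratio_encl11 R.
  lra.
- move: Bb; rewrite !big_ord_recr big_ord0 /= /zeta2_tail.
  lra.
Qed.

Lemma Fish_ratio_encl (R : realType) (S B l : R) :
  1 + 257 / 10 ^+ 3 + 746 / 10 ^+ 6 <= S <= 1 + 257 / 10 ^+ 3 + 748 / 10 ^+ 6 ->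
  1 + 644 / 10 ^+ 3 + 934 / 10 ^+ 6 <= B <= 1 + 644 / 10 ^+ 3 + 935 / 10 ^+ 6 ->
  693 / 10 ^+ 3 + 147 / 10 ^+ 6 + 17 / 10 ^+ 8 <= l
    <= 693 / 10 ^+ 3 + 147 / 10 ^+ 6 + 19 / 10 ^+ 8 ->
  `|l^-1 * (1 + S) / B - 198016%:R / 100000%:R| < 1 / 100000%:R.
Proof.
(* Factoring keeps the unary literals small. *)
have -> : 198016%:R = 448 * 442 :> R by lra.
have -> : 100000%:R = 1000 * 100 :> R by lra.
move=> /andP[S1 S2] /andP[B1 B2] /andP[l1 l2].
have B0 : 0 < B by lra.
have l0 : 0 < l by lra.
(* The quotient becomes [(1 + S) / (l * B)]. Once the product [l * B] is bounded and treated as a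
   single unknown, both inequalities are linear. *)
rewrite -mulrA mulrCA -invfM ltr_distl; apply/andP; split.
  rewrite ltr_pdivlMr ?mulr_gt0//.
  have : l * B <=
      (693 / 10 ^+ 3 + 147 / 10 ^+ 6 + 19 / 10 ^+ 8) * (1 + 644 / 10 ^+ 3 + 935 / 10 ^+ 6).
    by apply: ler_pM; [exact: ltW|exact: ltW|exact: l2|exact: B2].
  by move: (l * B) => P; lra.
rewrite ltr_pdivrMr ?mulr_gt0//.
have : (693 / 10 ^+ 3 + 147 / 10 ^+ 6 + 17 / 10 ^+ 8) * (1 + 644 / 10 ^+ 3 + 934 / 10 ^+ 6)
    <= l * B.
  by apply: ler_pM; [lra|lra|exact: l1|exact: B1].
by move: (l * B) => P; lra.
Qed.

Theorem mainTheorem1 (R : realType) (q : R) (hq : 1 < q) :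
  weakly_scale_invariant (pcsa_H q) (pcsa_I q) q /\
  H0 R \is a fin_num /\ I0 R \is a fin_num /\
  calH (pcsa_H q) q = (H0 R * ((ln q)^-1)%:E)%E /\
  calI (pcsa_I q) q = (I0 R * ((ln q)^-1)%:E)%E /\
  Fish (pcsa_H q) (pcsa_I q) q = fine (H0 R) / fine (I0 R) /\
  `| fine (H0 R) / fine (I0 R) - 198016%:R / 100000%:R | < 1 / 100000%:R.
Proof.
have [S [B [HE IE Sb Bb]]] := H0_I0_values R.
have l0 : 0 < ln q by exact: ln_gt0.
have B0 : B != 0.
  by move: Bb => /andP[B1 _]; apply: lt0r_neq0; apply: lt_le_trans B1; clear; lra.
split; first by apply: pcsa_weakly_scale_invariant; exact: lt_trans hq.
have cH := calH_pcsa hq; have cI := calI_pcsa hq.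
rewrite HE in cH *; rewrite IE in cI *.
split; first by [].
split; first by [].
split; first exact: cH.
split; first exact: cI.
split.
  rewrite /Fish cH cI -!EFinM /=.
  (* The common factor [1 / ln q] cancels in the quotient. *)
  by rewrite -mulf_div divff ?mulr1// invr_eq0 gt_eqF.
apply: Fish_ratio_encl Sb Bb _.
by have := ln_ratio_encl0 R; rewrite ln1 subr0.
Qed.
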